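(* Let $s\ge 2$ and $1\le d\le s$ be integers and let $1\le r\le\binom{s}{d}$. For $s<2d-r+2$, we have $$d_r(C_d)=(q-2)^{s-d-1}(q-1)^{d-r+1}\left[(q-1)^r-1\right].$$
   Context: $K=\mathbb{F}_q$ is the finite field with $q$ elements, $q$ a power of a prime, and $S=K[t_1,\dots,t_s]$. $KV_d$ is the $K$-span of the square-free monomials of degree $d$ in $S$, i.e. monomials $t_1^{a_1}\cdots t_s^{a_s}$ with all $a_i\in\{0,1\}$ and $\sum_{i=1}^s a_i=d$. $T=(\mathbb{F}_q^* )^s=\{P_1,\dots,P_m\}$, $m=(q-1)^s$, is the affine torus. The affine toric code $C_d$ (over the $d$-th hypersimplex) is the image of $KV_d\to\mathbb{F}_q^m$, $f\mapsto(f(P_1),\dots,f(P_m))$. $V_T(H)$ denotes the set of common zeros in $T$ of the polynomials in $H$. For $1\le r\le\dim_K KV_d$, the $r$-th generalized Hamming weight of $C_d$ is given by $$d_r(C_d):=\min\{|T\setminus V_T(H)| : H=\{f_1,\dots,f_r\}\subseteq KV_d \text{ is linearly independent over } K\}.$$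
   Formalization: For q = 2 and d = s (so r = 1) the stated formula is the undefined 0^{-1}·0; there the value is taken as (q-1)^s = 1, obtained by cancelling (q-2)^{-1} with (q-1)^r-1; all other cases use the formula as stated. *)

(* Defs.v *)
From HB Require Import structures.
From mathcomp Require Import all_boot all_order all_algebra.
From mathcomp Require Import mpoly.

Set Implicit Arguments.
Unset Strict Implicit.
Unset Printing Implicit Defensive.

Import GRing.Theory Num.Theory.
Local Open Scope ring_scope.

Definition sqfree_mon (s d : nat) (m : 'X_{1..s}) : bool :=
  [forall i, (m i <= 1)%N] && (mdeg m == d).

(* The type 'X_{1..s < d.+1} of multi-indices of degree at most d is finite and
   contains every square-free monomial of degree d. *)
Definition in_KV (K : finFieldType) (s d : nat) (f : {mpoly K[s]}) : Prop :=
  exists c : 'X_{1..s < d.+1} -> K,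
    f = \sum_(m : 'X_{1..s < d.+1} | sqfree_mon d m) c m *: 'X_[m].

Definition torus (K : finFieldType) (s : nat) : {set {ffun 'I_s -> K}} :=
  [set x : {ffun 'I_s -> K} | [forall i, x i != 0]].

Definition torus_zeros (K : finFieldType) (s r : nat)
    (H : r.-tuple {mpoly K[s]}) : {set {ffun 'I_s -> K}} :=
  [set x in torus K s | [forall j, (tnth H j).@[x] == 0]].

Definition lin_indep (K : finFieldType) (s r : nat)
    (H : r.-tuple {mpoly K[s]}) : Prop :=
  forall a : 'I_r -> K,
    \sum_(j < r) a j *: tnth H j = 0 -> forall j, a j = 0.

Definition ghw_value (K : finFieldType) (s d r w : nat) : Prop :=
  exists H : r.-tuple {mpoly K[s]},
    [/\ forall j, in_KV d (tnth H j),
        lin_indep H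
      & #|torus K s :\: torus_zeros H| = w].

(* [is_ghw K s d r w] says that w is the r-th generalized Hamming weight
   d_r(C_d) of the affine toric code of degree d in s variables over K: it is
   the minimum of the set of values.  The subspaces range over K V_d itself,
   not over its image C_d; the two differ when #|K| = 2, where the evaluation
   map need not be injective. *)
Definition is_ghw (K : finFieldType) (s d r w : nat) : Prop :=
  ghw_value K s d r w /\ forall w', ghw_value K s d r w' -> (w <= w')%N.

(* The exponents are integers, since s - d - 1 = -1 when d = s.  The only
   undefined instance is d = s, q = 2: there r = 1 is forced, the factors
   (q - 2)^(-1) and (q - 1)^r - 1 = q - 2 cancel formally, and what is left is
   (q - 1)^s = 1. *)
Definition ghw_formula (q s d r : nat) : rat :=
  if (q == 2)%N && (d == s) then 1
  else (q%:R - 2) ^ (s%:Z - d%:Z - 1) * (q%:R - 1) ^ (d%:Z - r%:Z + 1)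
       * ((q%:R - 1) ^+ r - 1).

(* Main.v *)
Require Import Defs.
From HB Require Import structures.
From mathcomp Require Import all_boot all_order all_algebra.
From mathcomp Require Import mpoly ring zify.

Set Implicit Arguments.
Unset Strict Implicit.
Unset Printing Implicit Defensive.

Import Order.TTheory GRing.Theory Num.Theory.
Local Open Scope ring_scope.

(** Put [z = 1/(q-1)].  For [d < s] the claimed weight is
    [(q-1)^s (1-z)^(s-d-1) (1-z^r)].

    Lower bound: split every [f] in an [r]-dimensional space [W] of square-free
    forms as [f = t_k g + h] with [g], [h] free of [t_k].  Above each point of the
    torus in the other variables, [W] is nonzero for every value of [t_k] if some
    [t_k g] in [W] is nonzero there, and for all values but at most one if some [h]
    is.  If [a > 0] is the dimension of the space of the [h] and [b = r - a], induction
    on the number of variables reduces the bound to [(z - z^a) (1 - z^b) >= 0]; the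
    exponent of [1-z] counts the variables missing from the monomials.

    Equality: with [k = s-d-1], multiply the [k] binomials [t_(2i) - t_(2i+1)] by
    the [r] differences [P/t_(2k+j) - P/t_(s-1)], where [P] is the product of the
    variables of index at least [2k]; the condition [s < 2d-r+2] says exactly that
    there are enough variables. *)

(** * The torus and square-free forms on it *)

Section Torus.
Variables (K : finFieldType) (s : nat).
Implicit Types (x : {ffun 'I_s -> K}) (k : 'I_s).

Definition upd k (c : K) x : {ffun 'I_s -> K} :=
  [ffun i => if i == k then c else x i].

Lemma torusP x : reflect (forall i, x i != 0) (x \in torus K s).
Proof. by rewrite inE; apply: forallP. Qed.

Lemma upd_torus k c x : c != 0 -> x \in torus K s -> upd k c x \in torus K s.
Proof.
by move=> c0 /torusP xT; apply/torusP => i; rewrite ffunE; case: (i =P k).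
Qed.

Lemma card_nonzero : #|[pred c : K | c != 0]| = #|K|.-1.
Proof. by rewrite -(cardC1 (0 : K)); apply: eq_card => c; rewrite !inE. Qed.

Lemma card_torus : #|torus K s| = (#|K|.-1 ^ s)%N.
Proof.
rewrite -card_nonzero -[X in (_ ^ X)%N](card_ord s) -card_ffun_on.
by apply: eq_card => x; rewrite inE; apply/forallP/ffun_onP => h i; move: (h i); rewrite inE.
Qed.

(** This replaces summation over the torus in the other variables: swapping [c] with the coordinate
    [x k] permutes the pairs of a torus point and a nonzero scalar. *)
Lemma sum_torus_fiber k (F : {ffun 'I_s -> K} -> nat) :
  (#|K|.-1 * \sum_(x in torus K s) F x =
   \sum_(x in torus K s) \sum_(c : K | c != 0%R) F (upd k c x))%N.
Proof.
rewrite big_distrr /=.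
under eq_bigr => x _ do rewrite -card_nonzero -sum_nat_const.
rewrite !pair_big /=.
pose h (u : {ffun 'I_s -> K} * K) := (upd k u.2 u.1, u.1 k).
have hK : involutive h.
  move=> [x c]; congr pair; last by rewrite /= ffunE eqxx.
  by apply/ffunP => i; rewrite !ffunE /=; case: eqP => // ->.
rewrite (reindex_inj (inv_inj hK)) /=; apply: eq_bigl => -[x c] /=.
apply/andP/andP => -[].
  move=> /torusP h1 h2; split; last by move: (h1 k); rewrite ffunE eqxx.
  apply/torusP => i; have := h1 i; rewrite ffunE; case: (i =P k) => [-> _|//].
  exact: h2.
by move=> xT c0; split; [exact: upd_torus | rewrite inE; move/torusP: xT].
Qed.

(** A set [B] stands for the product of its variables. Forms thus make up a finite-dimensional
    space, in which subspaces and dimensions make sense; no degree is imposed. *)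
Definition coefs := {ffun {set 'I_s} -> K^o}.

Definition evalc x (f : coefs) : K^o := \sum_B f B * \prod_(i in B) x i.

Fact evalc_is_linear x : linear (evalc x).
Proof.
move=> a f g; rewrite /evalc scaler_sumr -big_split; apply: eq_bigr => B _ /=.
by rewrite !ffunE mulrDl scalerAl.
Qed.
HB.instance Definition _ x :=
  GRing.isLinear.Build K coefs K^o _ (evalc x) (evalc_is_linear x).

(** This is the part [h] of [f = t_k g + h]; the kernel consists of the multiples of [t_k]. *)
Definition dropc k (f : coefs) : coefs :=
  [ffun B : {set 'I_s} => if k \in B then 0 else f B].

Fact dropc_is_linear k : linear (dropc k).
Proof.
move=> a f g; apply/ffunP => B; rewrite !ffunE; case: ifP => // _.
by rewrite scaler0 addr0.
Qed.
HB.instance Definition _ k :=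
  GRing.isLinear.Build K coefs coefs _ (dropc k) (dropc_is_linear k).

(** In [f = t_k g + h], the difference in parentheses is the value of [t_k g] at [x], which scales
    by [c / x k]; the factor [x k] on the left avoids the division. *)
Lemma evalc_upd k c x f : evalc (upd k c x) f * x k =
  c * (evalc x f - evalc x (dropc k f)) + x k * evalc x (dropc k f).
Proof.
rewrite /evalc -sumrB !mulr_sumr -big_split mulr_suml; apply: eq_bigr => B _ /=.
rewrite ffunE; case: ifPn => kB.
  rewrite !(big_setD1 _ kB) /= ffunE eqxx.
  under eq_bigr => i /setD1P [/negbTE ik _] do rewrite ffunE ik.
  by rewrite mul0r; ring.
under eq_bigr => i iB.
  rewrite ffunE; have -> : (i == k) = false by apply: contraNF kB => /eqP <-.
over.
by ring.
Qed.

(** * Torus points where a space of forms does not vanish *)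

Definition nonzero_at (W : {vspace coefs}) x : bool :=
  ~~ (W <= lker (linfun (evalc x)))%VS.

Lemma nonzero_atP (W : {vspace coefs}) x :
  reflect (exists2 f, f \in W & evalc x f != 0) (nonzero_at W x).
Proof.
apply: (iffP (@subvPn _ _ W _)) => -[f fW h]; exists f => //; move: h;
  by rewrite memv_ker lfunE.
Qed.

Definition nonzeros (W : {vspace coefs}) : nat :=
  \sum_(x in torus K s) nonzero_at W x.

(* Above a point of the torus of the other variables, [W] vanishes nowhere if its
   multiples of [t_k] do not all vanish there, and for at most one value of [t_k]
   if the part of [W] free of [t_k] does not vanish. *)
Lemma nonzeros_split k (W : {vspace coefs}) :
  (#|K|.-2 * nonzeros (linfun (dropc k) @: W)
   + nonzeros (W :&: lker (linfun (dropc k))) <= #|K|.-1 * nonzeros W)%N.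
Proof.
rewrite (sum_torus_fiber k) /nonzeros big_distrr -big_split leq_sum //= => x /torusP xT.
have K1 : (1 < #|K|)%N := card_finNzRing_gt1 K.
have xk := xT k.
have scaled c f : evalc (upd k c x) f =
    (c * (evalc x f - evalc x (dropc k f)) + x k * evalc x (dropc k f)) / x k.
  by rewrite -evalc_upd mulfK.
case: nonzero_atP => [hD|_] /=; last first.
  rewrite muln0 add0n; case: nonzero_atP => // -[f].
  rewrite memv_cap memv_ker lfunE /= => /andP[fW /eqP Df] fx.
  (* Only one unit has to be found on the right here, so the single value [c = 1] suffices. *)
  rewrite (bigD1 1) ?oner_neq0 //= ltn_addr // lt0b; apply/nonzero_atP; exists f => //.
  by rewrite scaled Df linear0 subr0 mulr0 addr0 mul1r mulf_neq0 ?invr_neq0.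
case: nonzero_atP => [[f]|_] /=.
  rewrite memv_cap memv_ker lfunE /= => /andP[fW /eqP Df] fx.
  rewrite muln1 (eq_bigr (fun=> 1%N)); last first.
    move=> c c0; apply/eqP; rewrite eqb1; apply/nonzero_atP; exists f => //.
    by rewrite scaled Df linear0 subr0 mulr0 addr0 !mulf_neq0 ?invr_neq0.
  by rewrite sum1_card card_nonzero; case: #|K| K1 => [|[|n]] //; rewrite addn1.
case: hD => _ /memv_imgP[f fW ->]; rewrite lfunE /= => Df.
set v := evalc x (dropc k f) in Df; pose u := evalc x f - v.
(* The root of [c * u + x k * v], the only value of [t_k] at which [f] can vanish. If [u = 0] there
   is no root, and division by zero gives the harmless [c0 = 0]. At least [q - 2] nonzero scalars
   differ from [c0]. *)
pose c0 := - (x k * v) / u.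
rewrite muln1 addn0.
apply: (@leq_trans (\sum_(c : K | (c != 0) && (c != c0)) 1)).
  rewrite sum1_card; have := cardsC [set 0; c0]; have := cards2 (0 : K) c0.
  move=> + h; have -> : #|[pred c : K | (c != 0) && (c != c0)]| = #|~: [set 0; c0]|.
    by apply: eq_card => c; rewrite !inE negb_or.
  by move=> c2; rewrite -subn2 -h leq_subLR leq_add2r c2; case: (0 != c0).
rewrite [leqRHS](bigID (fun c => c != c0)) /=; apply: leq_trans (leq_addr _ _).
apply: leq_sum => c /andP[c_neq0 cc0]; rewrite lt0b; apply/nonzero_atP; exists f => //.
rewrite scaled mulf_neq0 ?invr_neq0 // -/v -/u; apply: contraNneq cc0 => /eqP.
rewrite addr_eq0 => /eqP cu; rewrite /c0 -cu mulfK //.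
apply/eqP => u0; move/eqP: cu; rewrite u0 mulr0 eq_sym oppr_eq0.
by rewrite (negbTE (mulf_neq0 xk Df)).
Qed.

Local Notation q1 := (#|K|.-1%:R : rat).

Lemma q1_gt0 : 0 < q1.
Proof. by rewrite ltr0n -subn1 subn_gt0 card_finNzRing_gt1. Qed.

Lemma q1V_le1 : q1^-1 <= 1.
Proof. by rewrite invf_le1 ?q1_gt0 // ler1n -(ltr0n rat) q1_gt0. Qed.

Lemma nonzeros_split_rat k (W : {vspace coefs}) :
  (1 - q1^-1) * (nonzeros (linfun (dropc k) @: W))%:R
  + q1^-1 * (nonzeros (W :&: lker (linfun (dropc k))))%:R <= (nonzeros W)%:R :> rat.
Proof.
have := nonzeros_split k W; rewrite -(ler_nat rat) natrD !natrM.
have -> : #|K|.-2%:R = q1 - 1 :> rat.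
  by rewrite -[X in _ = _ - X]/(1%:R) -natrB ?subn1 // -(ltr0n rat) q1_gt0.
move=> h; rewrite -(ler_pM2l q1_gt0); apply: le_trans h.
by rewrite mulrDr !mulrA mulrBr mulr1 divff ?mul1r // gt_eqF ?q1_gt0.
Qed.

(** All forms are multiples of one monomial, and a monomial has no zero on the torus. *)
Lemma nonzeros_singleton (B0 : {set 'I_s}) (W : {vspace coefs}) :
  (forall f B, f \in W -> f B != 0 -> B = B0) ->
  (\dim W <= 1)%N /\ (W != 0%VS -> nonzeros W = #|torus K s|).
Proof.
move=> hW; have [-> | W0] := eqVneq W 0%VS; first by rewrite dimv0; split.
pose f := vpick W; have fW : f \in W := memv_pick W.
have f0 : f B0 != 0.
  move: W0; rewrite -vpick0 -/f; apply: contra => /eqP fB0; apply/eqP/ffunP => B.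
  rewrite [RHS]ffunE; apply/eqP/negP => /negP fB.
  by move: (fB); rewrite (hW _ _ fW fB) fB0 eqxx.
have supp g : g \in W -> forall B, B != B0 -> g B = 0.
  by move=> gW B; apply: contraNeq => /(hW _ _ gW) ->.
split.
  apply: (@leq_trans (\dim <[f]>)); last by rewrite dim_vline; case: (f != 0).
  apply/dimvS/subvP => g gW; apply/vlineP; exists (g B0 / f B0); apply/ffunP => B.
  rewrite !ffunE; have [->|BB0] := eqVneq B B0; first by rewrite /GRing.scale /= divfK.
  by rewrite (supp g gW B BB0) (supp f fW B BB0); exact/esym/mulr0.
move=> _; rewrite -sum1_card; apply: eq_bigr => x /torusP xT.
apply/eqP; rewrite eqb1; apply/nonzero_atP; exists f => //.
rewrite /evalc (bigD1 B0) //= [X in _ + X]big1 ?addr0; last first.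
  by move=> B BB0; rewrite (supp f fW B BB0) ?mul0r.
by rewrite mulf_neq0 //; apply/prodf_neq0 => i _; exact: xT.
Qed.

Lemma vspace_coef_neq0 (W : {vspace coefs}) :
  W != 0%VS -> exists f, exists B, f \in W /\ f B != 0.
Proof.
rewrite -vpick0 => W0; exists (vpick W); have [B fB|f0] := pickP (fun B => vpick W B != 0).
  by exists B; split=> //; exact: memv_pick.
case/eqP: W0; apply/ffunP => B; rewrite [RHS]ffunE; apply/eqP.
by rewrite -[_ == _]negbK f0.
Qed.

(* [A] is the set of variables not yet split off: all monomials of [W] agree
   outside [A].  Multiplying by [1 - q1^-1] lets [e = 0] serve as base case. *)
Lemma nonzeros_lower (A : {set 'I_s}) e (W : {vspace coefs}) :
  (forall f B, f \in W -> f B != 0 -> #|A :\: B| = e) ->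
  (forall f g B C, f \in W -> g \in W -> f B != 0 -> g C != 0 -> B :\: A = C :\: A) ->
  q1 ^+ s * (1 - q1^-1) ^+ e * (1 - q1^-1 ^+ \dim W)
    <= (1 - q1^-1) * (nonzeros W)%:R.
Proof.
set z := q1^-1; have z0 : 0 <= z by rewrite invr_ge0 ler0n.
have z1 : z <= 1 := q1V_le1.
have [n] := ubnP #|A|; elim: n A e W => // n IH A e W /ltnSE An hc hd.
have [->|W0] := eqVneq W 0%VS.
  by rewrite dimv0 expr0 subrr mulr0 mulr_ge0 ?subr_ge0.
have [f [B0 [fW fB0]]] := vspace_coef_neq0 W0.
(* For [e = 0] every monomial contains [A]; as they agree outside [A], only one monomial occurs. *)
case: e => [|e] in hc *.
  have [] := @nonzeros_singleton B0 W.
    move=> g B gW gB; move: (hc _ _ fW fB0) (hc _ _ gW gB) => /eqP + /eqP.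
    rewrite !cards_eq0 !setD_eq0 => AB0 AB.
    by rewrite -(setID B A) -(setID B0 A) (hd _ _ _ _ gW fW gB fB0) (setIidPr AB) (setIidPr AB0).
  move=> dW1 /(_ W0) ->; have -> : \dim W = 1%N.
    by apply/eqP; rewrite eqn_leq dW1 lt0n dimv_eq0.
  by rewrite card_torus natrX expr0 mulr1 expr1 mulrC.
(* Taking [k] outside a monomial that occurs in [W] makes the image under [dropc k] nonzero. *)
have [k] : exists k, k \in A :\: B0 by apply/card_gt0P; rewrite (hc f).
rewrite inE => /andP[kB0 kA].
set W1 := (linfun (dropc k) @: W)%VS; set W2 := (W :&: lker (linfun (dropc k)))%VS.
have suppW1 h B : h \in W1 -> h B != 0 -> k \notin B /\ exists2 g, g \in W & g B != 0.
  case/memv_imgP => g gW ->; rewrite lfunE ffunE; case: ifPn => [_|kB gB].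
    by rewrite eqxx.
  by split=> //; exists g.
have suppW2 h B : h \in W2 -> h B != 0 -> k \in B /\ h \in W.
  rewrite memv_cap memv_ker lfunE => /andP[hW /eqP/ffunP/(_ B)].
  by rewrite !ffunE; case: ifPn => // _ ->; rewrite eqxx.
have Akn : (#|A :\ k| < n)%N by apply: leq_trans An; rewrite [ltnRHS](cardsD1 k) kA.
have cardD B : #|A :\: B| = ((k \notin B) + #|(A :\ k) :\: B|)%N.
  rewrite (cardsD1 k) inE kA andbT; congr (_ + _)%N.
  by apply: eq_card => i; rewrite !inE andbCA.
have eqD (B C : {set 'I_s}) : (k \in B) = (k \in C) -> B :\: A = C :\: A ->
    B :\: (A :\ k) = C :\: (A :\ k).
  move=> kBC /setP eBC; apply/setP => i; have := eBC i; rewrite !inE.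
  by have [->|] := eqVneq i k; rewrite ?kBC.
(* When [k] leaves [A], monomials without [k] lose one missing variable, so [e.+1] drops to [e]; in
   [b2] they contain [k] and the exponent stays. *)
have b1 : q1 ^+ s * (1 - z) ^+ e * (1 - z ^+ \dim W1) <= (1 - z) * (nonzeros W1)%:R.
  apply: (IH (A :\ k)) => //.
    move=> h B hW hB; have [kB [g gW gB]] := suppW1 h B hW hB.
    by have := hc _ _ gW gB; rewrite cardD kB => -[].
  move=> h1 h2 B C h1W h2W h1B h2C.
  have [kB [g1 g1W g1B]] := suppW1 _ _ h1W h1B.
  have [kC [g2 g2W g2C]] := suppW1 _ _ h2W h2C.
  by apply: eqD (hd _ _ _ _ g1W g2W g1B g2C); rewrite (negbTE kB) (negbTE kC).
have b2 : q1 ^+ s * (1 - z) ^+ e.+1 * (1 - z ^+ \dim W2) <= (1 - z) * (nonzeros W2)%:R.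
  apply: (IH (A :\ k)) => //.
    move=> h B hW hB; have [kB hW'] := suppW2 h B hW hB.
    by have := hc _ _ hW' hB; rewrite cardD kB.
  move=> h1 h2 B C h1W h2W h1B h2C.
  have [kB h1W'] := suppW2 _ _ h1W h1B.
  have [kC h2W'] := suppW2 _ _ h2W h2C.
  by apply: eqD (hd _ _ _ _ h1W' h2W' h1B h2C); rewrite kB kC.
have a_gt0 : (0 < \dim W1)%N.
  rewrite lt0n dimv_eq0; apply/eqP => W10.
  have : linfun (dropc k) f \in W1 by exact: memv_img.
  rewrite W10 memv0 lfunE => /eqP/ffunP/(_ B0) /eqP.
  by rewrite !ffunE (negbTE kB0) (negbTE fB0).
have := nonzeros_split_rat k W.
rewrite -/z -/W1 -/W2 -(limg_ker_dim (linfun (dropc k)) W) -/W1 -/W2.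
set a := \dim W1 in b1 a_gt0 *; set b := \dim W2 in b2 *.
set N1 := (nonzeros W1)%:R in b1 *; set N2 := (nonzeros W2)%:R in b2 *.
move=> split; have {}split := ler_wpM2l (_ : 0 <= 1 - z) split.
rewrite addnC; apply: le_trans (split _); last by rewrite subr_ge0.
have -> : (1 - z) * ((1 - z) * N1 + z * N2)
    = (1 - z) * ((1 - z) * N1) + z * ((1 - z) * N2) by ring.
have c1 := ler_wpM2l (_ : 0 <= 1 - z) b1.
apply: le_trans (lerD (c1 _) (ler_wpM2l z0 b2)); last by rewrite subr_ge0.
rewrite -subr_ge0 exprD exprS.
set u := z ^+ a; set v := z ^+ b; set Q := q1 ^+ s; set P := (1 - z) ^+ e.
have -> : (1 - z) * (Q * P * (1 - u)) + z * (Q * ((1 - z) * P) * (1 - v))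
    - Q * ((1 - z) * P) * (1 - u * v) = Q * ((1 - z) * P) * ((z - u) * (1 - v)) by ring.
(* This is where [0 < \dim W1] enters. *)
have u_le : u <= z.
  by rewrite /u -(prednK a_gt0) exprS ler_piMr // exprn_ile1.
have v_le : v <= 1 by exact: exprn_ile1.
by rewrite !mulr_ge0 ?subr_ge0 ?exprn_ge0 ?ler0n ?subr_ge0.
Qed.

End Torus.

(** * Transfer to polynomials and the lower bound *)

Section Weights.
Variables (K : finFieldType) (s : nat).
Local Notation q1 := (#|K|.-1%:R : rat).

Lemma coefsZE a (f : coefs K s) B : (a *: f) B = a * f B.
Proof. exact: ffunE. Qed.

(** A square-free multi-index is determined by its support. The coefficient at [B] is still written
    as a sum over all indices of support [B], which avoids inverting [supp]. *)
Lemma in_KV_coefs d (f : {mpoly K[s]}) : in_KV d f ->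
  exists c : coefs K s, (forall B, c B != 0 -> #|B| = d)
    /\ f = \sum_B c B *: \prod_(i in B) 'X_i.
Proof.
case=> c ->; pose supp (m : 'X_{1..s < d.+1}) := [set i | m i != 0%N].
exists [ffun B => \sum_(m : 'X_{1..s < d.+1} | sqfree_mon d m && (supp m == B)) c m]; split=> [B|].
  rewrite ffunE; case: (pickP (fun m : 'X_{1..s < d.+1} => sqfree_mon d m && (supp m == B))).
    move=> m /andP[/andP[/forallP m1 /eqP md] /eqP <-] _; rewrite -[RHS]md.
    rewrite mdegE -sum1_card big_mkcond; apply: eq_bigr => i _ /=.
    by rewrite inE; have := m1 i; case: (m i : nat) => [|[]].
  by move=> h; rewrite big_pred0 ?eqxx.
rewrite (partition_big supp predT) //=; apply: eq_bigr => B _.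
rewrite ffunE scaler_suml; apply: eq_bigr => m /andP[/andP[/forallP m1 _] /eqP <-].
congr (_ *: _); rewrite mpolyXE_id [RHS]big_mkcond; apply: eq_bigr => i _ /=.
by rewrite inE; have := m1 i; case: (m i : nat) => [|[]].
Qed.

(** [W] is spanned by the coefficient functions of [H]. Where all members of [H] vanish, so does
    [W]; this inequality is enough for lower bounds on weights. *)
Lemma nonzeros_le_support d r (H : r.-tuple {mpoly K[s]}) :
  (forall j, in_KV d (tnth H j)) -> lin_indep H ->
  exists W : {vspace coefs K s},
    [/\ forall f B, f \in W -> f B != 0 -> #|B| = d, \dim W = r
      & (nonzeros W <= #|torus K s :\: torus_zeros H|)%N].
Proof.
move=> HK Hfree.
have [c hc] := fin_all_exists (fun j => in_KV_coefs (HK j)).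
pose X := [tuple c j | j < r].
have Xj (j : 'I_r) : X`_j = c j by rewrite -tnth_nth tnth_mktuple.
have supp f B : f \in <<X>>%VS -> f B != 0 -> #|B| = d.
  move=> fX; apply: contra_neq_eq => Bd; rewrite (coord_span fX) sum_ffunE.
  rewrite big1 // => j _; rewrite coefsZE Xj; have [/(_ B) h _] := hc j.
  have [->|/h /eqP] := eqVneq (c j B) 0; last by rewrite (negbTE Bd).
  by rewrite mulr0.
exists <<X>>%VS; split=> //.
  suff /eqP -> : free X by rewrite size_tuple.
  apply/freeP => a a0 j; apply: (Hfree a).
  rewrite (eq_bigr (fun j => \sum_B (a j * c j B) *: \prod_(i in B) 'X_i)); last first.
    by move=> i _; rewrite (hc i).2 scaler_sumr; apply: eq_bigr => B _; rewrite scalerA.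
  rewrite exchange_big big1 //= => B _; rewrite -scaler_suml.
  have /ffunP/(_ B) := a0; rewrite sum_ffunE [RHS]ffunE.
  rewrite (eq_bigr (fun i => a i * c i B)); last first.
    by move=> i _; rewrite -Xj; exact: coefsZE.
  by move=> ->; rewrite scale0r.
rewrite /nonzeros -sum1_card big_mkcond [leqRHS]big_mkcond leq_sum // => x _.
rewrite in_setD; case: ifP => xT //; rewrite andbT inE xT andTb.
case: forallP => [h|_]; last exact: leq_b1.
rewrite leqn0 eqb0; apply/nonzero_atP => -[f fX].
rewrite (coord_span fX) linear_sum big1 ?eqxx //= => j _.
rewrite linearZ /= Xj; have /eqP := h j; rewrite (hc j).2 raddf_sum /= => e.
suff -> : evalc x (c j) = 0 by exact: mulr0.
rewrite -{}e; apply: eq_bigr => B _; rewrite mevalZ rmorph_prod; congr (_ * _).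
by apply: eq_bigr => i _; rewrite [RHS]mevalXU.
Qed.

(** With [A] the set of all variables, each monomial misses exactly [s - d] of them. *)
Lemma ghw_lower d r (H : r.-tuple {mpoly K[s]}) :
  (forall j, in_KV d (tnth H j)) -> lin_indep H ->
  q1 ^+ s * (1 - q1^-1) ^+ (s - d) * (1 - q1^-1 ^+ r)
    <= (1 - q1^-1) * #|torus K s :\: torus_zeros H|%:R.
Proof.
move=> HK Hfree; have [W [supp dW hN]] := nonzeros_le_support HK Hfree.
rewrite -[X in _ * (1 - _ ^+ X) <= _]dW.
apply: le_trans (ler_wpM2l _ (_ : (nonzeros W)%:R <= _)); last by rewrite ler_nat.
  apply: (@nonzeros_lower _ _ setT) => [f B fW fB|f g B C _ _ _ _].
    by rewrite setTD cardsCs setCK card_ord (supp f).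
  by rewrite !setDT.
by rewrite subr_ge0 q1V_le1.
Qed.

(** For [d = s] and [q = 2] the general bound reads [0 <= 0]. Here the only monomial is the product
    of all variables, which settles every [q]. *)
Lemma ghw_lower_top r (H : r.-tuple {mpoly K[s]}) : (0 < r)%N ->
  (forall j, in_KV s (tnth H j)) -> lin_indep H ->
  (#|K|.-1 ^ s <= #|torus K s :\: torus_zeros H|)%N.
Proof.
move=> r0 HK Hfree; have [W [supp dW hN]] := nonzeros_le_support HK Hfree.
rewrite -card_torus; apply: leq_trans hN.
have suppT f B : f \in W -> f B != 0 -> B = [set: 'I_s].
  move=> fW /(supp _ _ fW) Bs; apply/eqP.
  by rewrite eqEcard subsetT cardsT card_ord Bs /=.
have [_ -> //] := nonzeros_singleton suppT.
by rewrite -dimv_eq0 dW -lt0n.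
Qed.

(** * Square-free polynomials in prescribed variables *)

Definition sqfree_on (A : {set 'I_s}) d (f : {mpoly K[s]}) :=
  forall m, m \in msupp f -> (forall i, (m i <= (i \in A))%N) /\ mdeg m = d.

Lemma sqfree_on_in_KV A d f : sqfree_on A d f -> in_KV d f.
Proof.
move=> hf; exists (fun m => f@_m); rewrite {1}(@mpolywE _ _ d.+1 f); last first.
  by rewrite msizeE; apply/bigmax_leqP_seq => m /hf [_ ->].
rewrite [RHS]big_mkcond; apply: eq_bigr => m _; case: ifPn => // hm.
suff /memN_msupp_eq0 -> : (m : 'X_{1..s}) \notin msupp f by rewrite scale0r.
apply: contra hm => /hf [m1 md]; rewrite /sqfree_mon md eqxx andbT.
by apply/forallP => i; apply: leq_trans (m1 i) (leq_b1 _).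
Qed.

(** Disjoint sets of variables keep the exponents of a product at most 1. *)
Lemma sqfree_onM (A B : {set 'I_s}) d e f g : [disjoint A & B] ->
  sqfree_on A d f -> sqfree_on B e g -> sqfree_on (A :|: B) (d + e) (f * g).
Proof.
move=> AB hf hg _ /msuppM_le /allpairsP[[m1 m2] /= [/hf [h1 <-] /hg [h2 <-] ->]].
rewrite mdegD; split=> // i; rewrite mnmDE inE.
apply: leq_trans (leq_add (h1 i) (h2 i)) _.
by case: (boolP (i \in A)) => // /(disjointFr AB) ->.
Qed.

Lemma sqfree_onB A d f g : sqfree_on A d f -> sqfree_on A d g -> sqfree_on A d (f - g).
Proof. by move=> hf hg m /msuppB_le; rewrite mem_cat => /orP[/hf|/hg]. Qed.

Lemma sqfree_onS (A B : {set 'I_s}) d f : A \subset B -> sqfree_on A d f -> sqfree_on B d f.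
Proof.
move=> /subsetP AB hf m /hf [h ?]; split=> // i; apply: leq_trans (h i) _.
by case: (boolP (i \in A)) => // /AB ->.
Qed.

Definition set_mnm (A : {set 'I_s}) : 'X_{1..s} := [multinom (i \in A : nat) | i < s].

Lemma set_mnm_inj : injective set_mnm.
Proof.
move=> A B /mnmP AB; apply/setP => i; have := AB i; rewrite !mnmE.
by case: (i \in A); case: (i \in B).
Qed.

Lemma sqfree_on_set_mnm (A : {set 'I_s}) : sqfree_on A #|A| 'X_[set_mnm A].
Proof.
move=> m /mem_msuppXP <-; split=> [i|]; first by rewrite mnmE.
by rewrite mdegE -sum1_card [RHS]big_mkcond; apply: eq_bigr => i _; rewrite mnmE; case: (_ \in _).
Qed.

Lemma meval_set_mnm (A : {set 'I_s}) (x : {ffun 'I_s -> K}) :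
  ('X_[set_mnm A]).@[x] = \prod_(i in A) x i.
Proof.
rewrite mevalX [RHS]big_mkcond; apply: eq_bigr => i _.
by rewrite mnmE; case: (i \in A).
Qed.

Lemma sqfree_onXB (a b : 'I_s) : sqfree_on [set a; b] 1 ('X_a - 'X_b).
Proof.
have X1 (c : 'I_s) : sqfree_on [set c] 1 'X_c.
  move=> m /mem_msuppXP <-; rewrite mdeg1; split=> // i.
  by rewrite mnm1E inE eq_sym.
apply: sqfree_onB; [apply: sqfree_onS (X1 a) | apply: sqfree_onS (X1 b)];
  by apply/subsetP => i; rewrite !inE => ->; rewrite ?orbT.
Qed.

Lemma mpolyXB_neq0 (a b : 'I_s) : a != b -> 'X_a - 'X_b != 0 :> {mpoly K[s]}.
Proof.
move=> ab; apply/eqP => /(congr1 (mcoeff U_(a))); rewrite mcoeffB mcoeff0 !mcoeffXU.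
by rewrite eqxx eq_sym (negbTE ab) subr0 => /eqP; rewrite oner_eq0.
Qed.

(** * Counting torus points by equality of coordinates *)

Definition count_torus (P : pred {ffun 'I_s -> K}) : rat :=
  #|[set x in torus K s | P x]|%:R.

Lemma count_torusE P : count_torus P = (\sum_(x in torus K s) P x)%:R.
Proof.
rewrite /count_torus -sum1_card big_mkcond [in RHS]big_mkcond; congr _%:R.
by apply: eq_bigr => x _; rewrite inE; case: (x \in _) => //=; case: (P x).
Qed.

Lemma count_torus_split (P Q : pred {ffun 'I_s -> K}) :
  count_torus P = count_torus [pred x | P x && Q x] + count_torus [pred x | P x && ~~ Q x].
Proof.
rewrite !count_torusE -natrD -big_split; congr _%:R; apply: eq_bigr => x _ /=.
by case: (P x); case: (Q x).
Qed.

(** As [P] ignores coordinate [k], exactly one of the [q - 1] choices for it meets the equation. *)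
Lemma count_torus_eq (P : pred {ffun 'I_s -> K}) k l :
  k != l -> (forall c x, P (upd k c x) = P x) ->
  count_torus [pred x | P x && (x k == x l)] = q1^-1 * count_torus P.
Proof.
move=> kl hP; apply: (mulfI (lt0r_neq0 (q1_gt0 K))); rewrite mulrA divff ?lt0r_neq0 ?q1_gt0 //.
rewrite mul1r !count_torusE -natrM (sum_torus_fiber k); congr _%:R.
apply: eq_bigr => x /torusP xT; under eq_bigr => c _ do rewrite /= hP.
rewrite (bigD1 (x l)) //= !ffunE eqxx [l == k]eq_sym (negbTE kl) eqxx andbT big1 ?addn0 // => c.
case/andP=> _ cx; rewrite !ffunE eqxx [l == k]eq_sym (negbTE kl) (negbTE cx).
by rewrite andbF.
Qed.

Lemma count_torus_neq (P : pred {ffun 'I_s -> K}) k l :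
  k != l -> (forall c x, P (upd k c x) = P x) ->
  count_torus [pred x | P x && (x k != x l)] = (1 - q1^-1) * count_torus P.
Proof.
move=> kl hP; rewrite mulrBl mul1r -(count_torus_eq kl hP).
by rewrite [X in X - _](count_torus_split P (fun x => x k == x l)) addrC addKr.
Qed.

End Weights.

(** * A space of forms attaining the bound *)

Section Optimal.
Variables (K : finFieldType) (s k r : nat).
Hypothesis bound_kr : (k.*2 + r <= s)%N.
Local Notation q1 := (#|K|.-1%:R : rat).
Local Notation v n := (inord n : 'I_s.+1).
Implicit Types x : {ffun 'I_s.+1 -> K}.

Definition pairs_poly n : {mpoly K[s.+1]} :=
  \prod_(i < n) ('X_(v i.*2) - 'X_(v i.*2.+1)).

Definition tail : {set 'I_s.+1} := [set i : 'I_s.+1 | (k.*2 <= i)%N].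

Definition tail_poly (l : 'I_s.+1) : {mpoly K[s.+1]} := 'X_[set_mnm (tail :\ l)].

(** By [bound_kr] the indices [k.*2 + j] are distinct and lie below the last index [s]. The degree
    is [k + (s - k.*2) = s - k]. *)
Definition optimal : r.-tuple {mpoly K[s.+1]} :=
  [tuple pairs_poly k * (tail_poly (v (k.*2 + j)) - tail_poly ord_max) | j < r].

Definition pairs_distinct n x := all (fun i => x (v i.*2) != x (v i.*2.+1)) (iota 0 n).

Definition tail_equal n x := all (fun j => x (v (k.*2 + j)) == x ord_max) (iota 0 n).

(** The bounds matter: [inord] sends every index above [s] to 0. *)
Lemma inord_inj m n : (m <= s)%N -> (n <= s)%N -> v m = v n -> m = n.
Proof. by move=> ms ns /(congr1 (@nat_of_ord _)); rewrite !inordK ?ltnS. Qed.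

Lemma inord_neq m n : (m <= s)%N -> (n <= s)%N -> m != n -> v m != v n.
Proof. by move=> ms ns; apply: contraNneq => /(inord_inj ms ns) ->. Qed.

Lemma pairs_poly_sqfree n : (n <= k)%N ->
  sqfree_on [set i : 'I_s.+1 | (i < n.*2)%N] n (pairs_poly n).
Proof.
elim: n => [|n IH] nk.
  rewrite /pairs_poly big_ord0 => m; rewrite -mpolyX0 => /mem_msuppXP <-.
  by split=> [i|]; rewrite ?mnm0E ?mdeg0.
rewrite /pairs_poly big_ord_recr /= -[X in sqfree_on _ X]addn1.
have := @sqfree_onM _ _ _ [set v n.*2; v n.*2.+1] _ _ _ _ _ (IH (ltnW nk)) (@sqfree_onXB _ _ _ _).
have n1 : (n.*2 < s.+1)%N by lia.
have n2 : (n.*2.+1 < s.+1)%N by lia.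
move=> h; apply: sqfree_onS (h _).
  apply/subsetP => i; rewrite !inE -!val_eqE /= !inordK //; lia.
rewrite disjoint_subset; apply/subsetP => i; rewrite !inE -!val_eqE /= !inordK //; lia.
Qed.

Lemma mem_tail j : (j <= s - k.*2)%N -> v (k.*2 + j) \in tail.
Proof. by move=> js; rewrite inE inordK ?leq_addr //; lia. Qed.

Lemma max_tail : ord_max \in tail.
Proof. by rewrite inE /=; lia. Qed.

Lemma card_tail : #|tail| = (s.+1 - k.*2)%N.
Proof.
have -> : tail = ~: [set i : 'I_s.+1 | (i < k.*2)%N].
  by apply/setP => i; rewrite !inE -leqNgt.
rewrite cardsCs setCK card_ord; congr (_ - _)%N.
rewrite -sum1dep_card -(big_ord_widen s.+1 (fun=> 1%N)) ?sum1_card ?card_ord //; lia.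
Qed.

Lemma tail_poly_sqfree l : l \in tail -> sqfree_on tail (s - k.*2) (tail_poly l).
Proof.
move=> lt; apply: sqfree_onS (subD1set _ l) _.
have -> : (s - k.*2)%N = #|tail :\ l|.
  by have := cardsD1 l tail; rewrite lt card_tail; lia.
exact: sqfree_on_set_mnm.
Qed.

Lemma optimal_in_KV j : in_KV (s - k) (tnth optimal j).
Proof.
rewrite tnth_mktuple; have jr := ltn_ord j.
have -> : (s - k)%N = (k + (s - k.*2))%N by lia.
apply: sqfree_on_in_KV; apply: sqfree_onM (pairs_poly_sqfree (leqnn k)) _; last first.
  by apply: sqfree_onB; apply: tail_poly_sqfree; [apply: mem_tail; lia | exact: max_tail].
by rewrite disjoint_subset; apply/subsetP => i; rewrite !inE; lia.
Qed.

Lemma pairs_poly_neq0 : pairs_poly k != 0.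
Proof.
apply/prodf_neq0 => i _; have ik := ltn_ord i.
by apply: mpolyXB_neq0; apply: inord_neq; lia.
Qed.

(** The common factor cancels, and the monomial [tail_poly (v (k.*2 + j))] occurs in the [j]-th
    difference only. *)
Lemma optimal_lin_indep : lin_indep optimal.
Proof.
move=> a; under eq_bigr => j _ do rewrite tnth_mktuple scalerAr.
rewrite -mulr_sumr => /eqP; rewrite mulf_eq0 (negbTE pairs_poly_neq0) /= => /eqP h j.
have jr := ltn_ord j.
have tail_inj l1 l2 : l1 \in tail -> l2 \in tail ->
    (set_mnm (tail :\ l1) == set_mnm (tail :\ l2)) = (l1 == l2).
  move=> t1 t2; apply/eqP/eqP => [/set_mnm_inj/setP/(_ l1)|-> //].
  by rewrite !in_setD1 eqxx t1 /= andbT => /esym/negbFE/eqP.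
have max_neq : (ord_max == v (k.*2 + j)) = false.
  by apply/negbTE; rewrite -val_eqE /= inordK; lia.
have := congr1 (mcoeff (set_mnm (tail :\ v (k.*2 + j)))) h.
rewrite raddf_sum mcoeff0 (bigD1 j) //= big1 => [|i ij]; last first.
  have ir := ltn_ord i.
  rewrite mcoeffZ mcoeffB !mcoeffX !tail_inj ?max_tail ?mem_tail //; try lia.
  rewrite max_neq subr0 (_ : (v _ == v _) = false) ?mulr0 //.
  by apply/negbTE/inord_neq; rewrite ?eqn_add2l //; lia.
rewrite mcoeffZ mcoeffB !mcoeffX !tail_inj ?max_tail ?mem_tail //; try lia.
by rewrite eqxx addr0 max_neq subr0 mulr1.
Qed.

(** On the torus [tail_poly l] takes the value [p / x l] with one [p != 0] for all [l], so a
    difference of two vanishes exactly when the coordinates agree. *)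
Lemma optimal_nonzero x : x \in torus K s.+1 ->
  [forall j, (tnth optimal j).@[x] == 0] = ~~ pairs_distinct k x || tail_equal r x.
Proof.
move=> /torusP xT.
have evE j : (tnth optimal j).@[x] =
    (pairs_poly k).@[x] * ((tail_poly (v (k.*2 + j))).@[x] - (tail_poly ord_max).@[x]).
  by rewrite tnth_mktuple mevalM mevalB.
have pE : (pairs_poly k).@[x] = \prod_(i < k) (x (v i.*2) - x (v i.*2.+1)).
  by rewrite rmorph_prod; apply: eq_bigr => i _; rewrite [LHS]mevalB !mevalXU.
have tE l : l \in tail -> (tail_poly l).@[x] = (\prod_(i in tail) x i) / x l.
  by move=> lt; rewrite meval_set_mnm (big_setD1 _ lt) /= mulrC mulKf.
have P0 : \prod_(i in tail) x i != 0 by apply/prodf_neq0 => i _; exact: xT.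
have tail_eq (j : 'I_r) : ((tnth optimal j).@[x] == 0) =
   ((pairs_poly k).@[x] == 0) || (x (v (k.*2 + j)) == x ord_max).
  have jr := ltn_ord j.
  rewrite evE mulf_eq0 subr_eq0 !tE ?max_tail ?mem_tail; try lia.
  by rewrite (inj_eq (mulfI P0)) (inj_eq invr_inj).
have -> : pairs_distinct k x = ((pairs_poly k).@[x] != 0).
  rewrite pE; apply/allP/prodf_neq0 => [h i _|h i].
    by rewrite subr_eq0; apply: h; rewrite mem_iota /=.
  by rewrite mem_iota add0n => /= ik; have := h (Ordinal ik) isT; rewrite subr_eq0.
rewrite negbK; apply/forallP/idP => [h|].
  case: eqVneq => //= p0; apply/allP => j; rewrite mem_iota add0n /= => jr.
  by have := h (Ordinal jr); rewrite tail_eq (negbTE p0).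
case/orP => [p0|/allP h] j; rewrite tail_eq ?p0 // h ?orbT //.
by rewrite mem_iota /=.
Qed.

Lemma upd_inord m n c x : (m <= s)%N -> (n <= s)%N -> m != n -> upd (v m) c x (v n) = x (v n).
Proof. by move=> ms ns mn; rewrite ffunE eq_sym (negbTE (inord_neq ms ns mn)). Qed.

Lemma pairs_distinct_upd n m c x : (n <= k)%N -> (n.*2 <= m <= s)%N ->
  pairs_distinct n (upd (v m) c x) = pairs_distinct n x.
Proof.
move=> nk /andP[nm ms]; apply: eq_in_all => i; rewrite mem_iota add0n /= => ni.
by rewrite !upd_inord //; lia.
Qed.

(** Coordinate [n.*2] is absent from the earlier pairs, so each new pair costs a factor
    [1 - q1^-1]. *)
Lemma count_pairs_distinct n : (n <= k)%N ->
  count_torus (pairs_distinct n) = q1 ^+ s.+1 * (1 - q1^-1) ^+ n.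
Proof.
elim: n => [_|n IH nk].
  rewrite /count_torus (eq_card (B := torus K s.+1)) ?card_torus ?natrX ?mulr1 //.
  by move=> x; rewrite inE andbT.
rewrite [_ ^+ n.+1]exprS mulrCA -(IH (ltnW nk)).
rewrite -(@count_torus_neq _ _ _ (v n.*2) (v n.*2.+1)).
- congr (_%:R); apply: eq_card => x.
  by rewrite !inE /pairs_distinct -[n.+1]addn1 iotaD all_cat /= andbT.
- by apply: inord_neq; lia.
- by move=> c x; apply: pairs_distinct_upd; lia.
Qed.

(** Each equation ties a fresh coordinate [k.*2 + n] to the last one, at the cost of a factor
    [q1^-1]. *)
Lemma count_tail_equal n : (n <= r)%N ->
  count_torus [pred x | pairs_distinct k x && tail_equal n x]
  = q1 ^+ s.+1 * (1 - q1^-1) ^+ k * q1^-1 ^+ n.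
Proof.
elim: n => [_|n IH nr].
  rewrite mulr1 -count_pairs_distinct //; congr (_%:R).
  by apply: eq_card => x; rewrite !inE andbT.
rewrite [_ ^+ n.+1]exprS mulrCA -(IH (ltnW nr)).
rewrite -(@count_torus_eq _ _ _ (v (k.*2 + n)) ord_max).
- congr (_%:R); apply: eq_card => x.
  by rewrite !inE /tail_equal -[n.+1]addn1 iotaD all_cat /= andbT !andbA.
- by rewrite -val_eqE /= inordK; lia.
move=> c x /=; rewrite pairs_distinct_upd //; last lia.
congr (_ && _); apply: eq_in_all => i; rewrite mem_iota add0n /= => ni.
rewrite upd_inord //; try lia.
rewrite ffunE (_ : (ord_max == _) = false) //; apply/negbTE.
by rewrite -val_eqE /= inordK; lia.
Qed.

(** Nonzeros are the points with distinct pairs, minus those among them with all tail equalities. *)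
Lemma optimal_weight :
  #|torus K s.+1 :\: torus_zeros optimal|%:R
  = q1 ^+ s.+1 * (1 - q1^-1) ^+ k * (1 - q1^-1 ^+ r) :> rat.
Proof.
rewrite mulrBr mulr1 -count_tail_equal // -count_pairs_distinct //.
rewrite [X in X - _](count_torus_split _ (tail_equal r)) addrC addKr.
congr (_%:R); apply: eq_card => x; rewrite [LHS]inE [RHS]inE [x \in torus_zeros _]inE.
case: (boolP (x \in torus K s.+1)) => xT; last by rewrite andbF.
by rewrite !andTb andbT optimal_nonzero // negb_or negbK.
Qed.

End Optimal.

(** * Minimality and the closed formula *)

Lemma optimal_ghw (K : finFieldType) (s k r : nat) : (k.*2 + r <= s)%N ->
  is_ghw K s.+1 (s - k) r #|torus K s.+1 :\: torus_zeros (optimal K s k r)|.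
Proof.
move=> kr; split.
  exists (optimal K s k r); split=> // [j|]; last exact: optimal_lin_indep.
  exact: optimal_in_KV.
move=> _ [H [HK Hfree <-]]; rewrite -(ler_nat rat) optimal_weight //.
have := ghw_lower HK Hfree; have -> : (s.+1 - (s - k))%N = k.+1 by lia.
(* The extra factor [1 - q1^-1] of the lower bound cancels unless [q = 2]; in that case the weight
   to be bounded is 0. *)
set q1 := #|K|.-1%:R; have [-> _|q1_neq1] := eqVneq q1 (1 : rat).
  by rewrite invr1 !expr1n subrr mulr0 ler0n.
have p_gt0 : 0 < 1 - q1^-1.
  by rewrite lt_neqAle subr_ge0 q1V_le1 eq_sym subr_eq0 eq_sym invr_eq1 q1_neq1.
by rewrite [_ ^+ k.+1]exprS mulrCA -[in X in X -> _]mulrA ler_pM2l.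
Qed.

Lemma top_ghw (K : finFieldType) (s : nat) : is_ghw K s s 1 (#|K|.-1 ^ s).
Proof.
split; last by move=> _ [H [HK Hfree <-]]; exact: ghw_lower_top.
have mon_nz : 'X_[set_mnm [set: 'I_s]] != 0 :> {mpoly K[s]}.
  by rewrite -msupp_eq0 msuppX.
exists [tuple 'X_[set_mnm setT]]; split=> [j|a|].
- rewrite ord1 /=; apply: sqfree_on_in_KV.
  by have := @sqfree_on_set_mnm K s setT; rewrite cardsT card_ord; apply.
- rewrite big_ord1 /= => /eqP; rewrite scaler_eq0 (negbTE mon_nz) orbF => /eqP a0 j.
  by rewrite ord1.
rewrite -card_torus; apply: eq_card => x; rewrite [LHS]inE.
case: (boolP (x \in torus K s)) => xT; last by rewrite andbF.
rewrite andbT inE xT /= negb_forall; apply/existsP; exists ord0.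
rewrite /= meval_set_mnm; apply/prodf_neq0 => i _; exact/torusP.
Qed.

Theorem corollary4p5 (K : finFieldType) (s d r : nat)
  (hs : (2 <= s)%N) (hd : (1 <= d <= s)%N) (hr : (1 <= r <= 'C(s, d))%N)
  (hsdr : s%:Z < 2 * d%:Z - r%:Z + 2) :
  exists2 w : nat, is_ghw K s d r w & w%:R = ghw_formula #|K| s d r.
Proof.
have q_gt1 : (1 < #|K|)%N := card_finNzRing_gt1 K.
have q1E : #|K|%:R - 1 = #|K|.-1%:R :> rat by rewrite -(natrB _ (ltnW q_gt1)) subn1.
have q2E : #|K|%:R - 2 = #|K|.-1%:R - 1 :> rat by rewrite -q1E; ring.
have q1_neq0 := lt0r_neq0 (q1_gt0 K).
case/andP: hd => _; rewrite leq_eqVlt => /orP[/eqP ds|].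
  subst d; have -> : r = 1%N by move: hr; rewrite binn; lia.
  exists (#|K|.-1 ^ s)%N; first exact: top_ghw.
  rewrite /ghw_formula eqxx andbT; case: ifPn => [/eqP -> |q_neq2]; first by rewrite exp1n.
  (* Here [q - 2] has exponent [-1] and cancels against [(q - 1) ^ 1 - 1], nonzero since [q] is not
     2. *)
  rewrite q2E q1E subrr sub0r subrK expr1 -exprnP natrX mulrAC mulVf ?mul1r //.
  rewrite subr_eq0 -[1]/(1%:R) eqr_nat; lia.
case: s hs hr hsdr => // s hs hr hsdr; rewrite ltnS => ds.
(* [s] is now one less than the number of variables, so [k = s - d] is the exponent of [q - 2]. *)
have [k [-> kr]] : exists k, d = (s - k)%N /\ (k.*2 + r <= s)%N.
  by exists (s - d)%N; lia.
exists #|torus K s.+1 :\: torus_zeros (optimal K s k r)|; first exact: optimal_ghw.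
rewrite optimal_weight // /ghw_formula ifN; last by apply/nandP; right; lia.
have -> : s.+1%:Z - (s - k)%N%:Z - 1 = k%:Z by lia.
have -> : (s - k)%N%:Z - r%:Z + 1 = (s - k - r + 1)%N%:Z by lia.
rewrite q2E q1E -!exprnP.
(* The power of [q1] is shared out: [k] factors turn [1 - q1^-1] into [q - 2], and [r] factors turn
   [1 - q1^-1 ^+ r] into [q1 ^+ r - 1]. *)
have -> : s.+1 = (k + (s - k - r + 1) + r)%N by lia.
rewrite !exprD; set q1 := #|K|.-1%:R in q1_neq0 *; set e := (s - k - r)%N.
have -> : q1 - 1 = q1 * (1 - q1^-1) by rewrite mulrBr mulr1 divff.
rewrite exprMn exprVn; field; exact: expf_neq0.
Qed.
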